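(* Let $\mathcal R^\wedge,\mathcal R^\vee\subset\mathbb Z^2$ be finite sets of vectors with $\mathcal R^\vee=R_\pi(\mathcal R^\wedge)$, where $R_\pi:\boldsymbol\delta\mapsto-\boldsymbol\delta$ is rotation by $\pi$. Then the squeezing code $\mathcal A$ defined by $\mathcal R^\wedge,\mathcal R^\vee$ is not a robust memory.
   Context: Spins $s_{\mathbf r}\in\{+1,-1\}$ live on the sites of an $L\times L$ square lattice with periodic boundary conditions. A spin $+1$ is treated as Boolean true and $-1$ as false, so $a\wedge b=\min(a,b)$, $a\vee b=\max(a,b)$. The squeezing code defined by $\mathcal R^\wedge,\mathcal R^\vee$ is the synchronous rule $s_{\mathbf r}(t+1)=\bigwedge_{\boldsymbol\delta\in\mathcal R^\wedge}s_{\mathbf r+\boldsymbol\delta}(t)$ for $t$ even and $s_{\mathbf r}(t+1)=\bigvee_{\boldsymbol\delta\in\mathcal R^\vee}s_{\mathbf r+\boldsymbol\delta}(t)$ for $t$ odd, all sites updated simultaneously. Noisy dynamics with noise strength $p\in[0,1]$ and bias $\eta\in[-1,1]$: at each time step, independently for each site, the spin takes the value given by the rule with probability $1-p$, and otherwise is set to $+1$ with probability $p(1+\eta)/2$ and to $-1$ with probability $p(1-\eta)/2$. Let $s_\pm$ be the all-$(\pm1)$ configurations and $m(s)=L^{-2}\sum_{\mathbf r}s_{\mathbf r}$. The memory time is $t_{\rm mem}=\mathbb E\,\min_{\pm}\{t:\pm m[\mathcal A^t(s_\pm)]<1/2\}$ (expectation over noise). $\mathcal A$ is a robust memory if there is an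 open ball in the $(p,\eta)$ plane, with radius remaining finite as $L\to\infty$, such that $\lim_{L\to\infty}t_{\rm mem}=\infty$ for all $(p,\eta)$ in the ball. *)

(* Defs.v *)
From HB Require Import structures.
From mathcomp Require Import all_boot all_order all_algebra.
From mathcomp Require Import all_classical all_reals all_analysis.
Set Implicit Arguments. Unset Strict Implicit. Unset Printing Implicit Defensive.
Import Order.TTheory GRing.Theory Num.Theory.
Local Open Scope ring_scope.

(* Lattice of side n.+1 (so side length L = n.+1 >= 1), periodic b.c.
   Sites are pairs of ordinals; vectors of Z^2 are pairs of ints.
   Spin +1 is encoded by [true], -1 by [false]. *)
Definition site (n : nat) : finType := ('I_n.+1 * 'I_n.+1)%type.
Definition config (n : nat) : finType := {ffun site n -> bool}.

Definition vec := (int * int)%type.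

Definition shift1 (n : nat) (x : 'I_n.+1) (d : int) : 'I_n.+1 :=
  inord `|((x%:Z + d) %% (n.+1)%:Z)%Z|%N.

Definition shift (n : nat) (r : site n) (d : vec) : site n :=
  (shift1 r.1 d.1, shift1 r.2 d.2).

Definition rule (Rw Rv : seq vec) (n : nat) (t : nat) (s : config n)
  (r : site n) : bool :=
  if ~~ odd t then \big[andb/true]_(d <- Rw) s (shift r d)
  else \big[orb/false]_(d <- Rv) s (shift r d).

(* Per-site noise outcome: None = apply the rule, Some b = reset to b. *)
Definition noise (n : nat) : finType := {ffun site n -> option bool}.

Definition outcome_prob (R : realType) (p eta : R) (o : option bool) : R :=
  match o with
  | None => 1 - p
  | Some true => p * (1 + eta) / 2
  | Some false => p * (1 - eta) / 2
  end.

Definition noise_prob (R : realType) (p eta : R) (n : nat) (w : noise n) : R :=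
  \prod_(r : site n) outcome_prob p eta (w r).

Definition step (Rw Rv : seq vec) (n : nat) (t : nat) (w : noise n)
  (s : config n) : config n :=
  [ffun r => match w r with None => rule Rw Rv t s r | Some b => b end].

Fixpoint traj (Rw Rv : seq vec) (n : nat) (W : nat -> noise n)
  (k : nat) (s : config n) : config n :=
  match k with
  | 0 => s
  | k'.+1 => step Rw Rv k' (W k') (traj Rw Rv W k' s)
  end.

Definition splus (n : nat) : config n := [ffun => true].
Definition sminus (n : nat) : config n := [ffun => false].

Definition spin (R : realType) (b : bool) : R := if b then 1 else -1.

Definition magn (R : realType) (n : nat) (s : config n) : R :=
  ((n.+1 ^ 2)%:R)^-1 * \sum_(r : site n) spin R (s r).

(* finite noise history of length t, extended by "no noise" afterwards
   (the extension is never used below) *)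
Definition hist (n t : nat) (W : {ffun 'I_t -> noise n}) : nat -> noise n :=
  fun k => odflt [ffun => None] (omap W (insub k)).

Definition alive (R : realType) (Rw Rv : seq vec) (n t : nat)
  (W : {ffun 'I_t -> noise n}) : bool :=
  [forall k : 'I_t.+1,
     (1/2 <= magn R (traj Rw Rv (hist W) k (splus n))) &&
     (1/2 <= - magn R (traj Rw Rv (hist W) k (sminus n)))].

(* P(T > t), where T = min_{+-} {t : +- m[A^t(s_+-)] < 1/2};
   the event {T > t} depends only on the noise at steps 0..t-1. *)
Definition surv (R : realType) (Rw Rv : seq vec) (n : nat) (p eta : R)
  (t : nat) : R :=
  \sum_(W : {ffun 'I_t -> noise n})
     (\prod_(i < t) noise_prob p eta (W i)) * (alive R Rw Rv W)%:R.

(* t_mem = E[T] = sum_{t >= 0} P(T > t), valued in [0, +oo]. *)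
Definition tmem (R : realType) (Rw Rv : seq vec) (n : nat) (p eta : R)
  : \bar R :=
  (\sum_(0 <= t <oo) (surv Rw Rv n p eta t)%:E)%E.

Definition valid_params (R : realType) (p eta : R) : Prop :=
  0 <= p <= 1 /\ -1 <= eta <= 1.

Definition robust_memory (R : realType) (Rw Rv : seq vec) : Prop :=
  exists (p0 eta0 rad : R),
    0 < rad /\ valid_params p0 eta0 /\
    forall p eta : R, valid_params p eta ->
      (p - p0) ^+ 2 + (eta - eta0) ^+ 2 < rad ^+ 2 ->
      forall M : R, exists N : nat, forall n : nat, (N <= n)%N ->
        (M%:E <= tmem Rw Rv n p eta)%E.

(* Main.v *)
Require Import Defs.
From HB Require Import structures.
From mathcomp Require Import all_boot all_order all_algebra.
From mathcomp Require Import all_classical all_reals all_analysis.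
From mathcomp Require Import ring lra zify.
Import Order.TTheory GRing.Theory Num.Theory.
Local Open Scope ring_scope.
Set Implicit Arguments.
Unset Strict Implicit.

(** Let [b] be the spin value at least as likely under the noise: probability
    [al] against [be <= al].  One of the two half-steps shrinks the set of
    [b]-spins: [b] at [r] if all of the neighbourhood [N r] is [b].  The other
    spreads it: [b] at [y] iff some [r] with [y] in [N r] is [b].  As the two
    stencils are opposite, both use the same relation, so in the absence of noise
    spreading and then shrinking never loses a [b]-spin.  Hence a [b]-spin at [r]
    is lost in a period only if the noise produces [~~ b] at [r] or on [N r],
    while a site [y] with no [b]-spin to spread onto it acquires one as soon as
    the noise produces [b] at one of the [r] with [y] in [N r].  With [d = #|N r|],
    the mean fraction [u] of sites out of reach of the spreading thus evolves by
    [u' <= (1 - u) (1 - (1 - be) ^ d.+1) + u (1 - al) ^ d], whose fixed point is at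
    most 2/3, whatever [p > 0], [d > 0] and the lattice size.  The configuration
    started from all [~~ b] must keep at least 3/4 of its spins [~~ b] to stay
    alive; a Lyapunov function then bounds the memory time uniformly in the
    lattice size at every point with [p > 0]. *)

(** * Averages over the noise of a single time step *)

Section OneStep.
Variables (R : realType) (p eta : R) (n : nat).
Hypothesis hpe : valid_params p eta.
Implicit Types (f : config n -> site n -> bool) (s : config n) (b c : bool).
Implicit Types phi psi : config n -> R.

Local Notation pr c := (outcome_prob p eta (Some c)).

Lemma outcome_prob_ge0 (o : option bool) : 0 <= outcome_prob p eta o.
Proof. by case: hpe => /andP[? ?] /andP[? ?]; case: o => [[]|] /=; nra. Qed.

Lemma outcome_probD b : pr b + pr (~~ b) = p.
Proof. by case: b => /=; field. Qed.

Lemma noise_prob_ge0 (w : noise n) : 0 <= noise_prob p eta w.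
Proof. by apply: prodr_ge0 => r _; apply: outcome_prob_ge0. Qed.

(** Sites are independent, so the sum over noise configurations factorises: a site of [S]
    contributes [1 - pr c], any other site its total mass 1. *)
Lemma noise_prob_avoid (S : {set site n}) c :
  \sum_(w : noise n) noise_prob p eta w * [forall r in S, w r != Some c]%:R
  = (1 - pr c) ^+ #|S|.
Proof.
pose F r o : R := outcome_prob p eta o * (if r \in S then (o != Some c)%:R else 1).
transitivity (\sum_(w : noise n) \prod_r F r (w r)).
  apply: eq_bigr => w _; rewrite big_split /=; congr (_ * _).
  case: (boolP [forall r in S, w r != Some c]) => [/forall_inP h|].
    by rewrite big1 // => r _; case: ifP => // /h ->.
  rewrite negb_forall => /existsP[r]; rewrite negb_imply => /andP[rS /negbTE e].
  by rewrite (bigD1 r) //= rS e mul0r.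
rewrite -(bigA_distr_bigA F) -prodr_const [RHS]big_mkcond; apply: eq_bigr => r _.
rewrite (bigD1 None) //= (bigD1 (Some true)) //= (bigD1 (Some false)) //=.
rewrite big1; last by case=> [[]|].
by rewrite /F; case: ifP => _; rewrite /=; move: (outcome_probD c); case: (c) => /=; rewrite ?eqxx /=; lra.
Qed.

Lemma noise_prob_sum : \sum_(w : noise n) noise_prob p eta w = 1.
Proof.
rewrite -(expr0 (1 - pr true)) -(cards0 (site n)) -noise_prob_avoid.
apply: eq_bigr => w _; case: forall_inP => [_|[]]; first by rewrite mulr1.
by move=> r; rewrite inE.
Qed.

Definition upd f (w : noise n) s : config n :=
  [ffun r => if w r is Some c then c else f s r].

Definition avg f phi s : R := \sum_(w : noise n) noise_prob p eta w * phi (upd f w s).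

Lemma avg_le f phi psi s : (forall s', phi s' <= psi s') -> avg f phi s <= avg f psi s.
Proof. by move=> h; apply: ler_sum => w _; rewrite ler_wpM2l ?noise_prob_ge0. Qed.

Lemma eq_avg f phi psi s : phi =1 psi -> avg f phi s = avg f psi s.
Proof. by move=> e; apply: eq_bigr => w _; rewrite e. Qed.

Lemma avg_cst f (a : R) s : avg f (fun=> a) s = a.
Proof. by rewrite /avg -mulr_suml noise_prob_sum mul1r. Qed.

Lemma avgD f phi psi s :
  avg f (fun s' => phi s' + psi s') s = avg f phi s + avg f psi s.
Proof. by rewrite -big_split; apply: eq_bigr => w _; rewrite mulrDr. Qed.

Lemma avgZ f (a : R) phi s : avg f (fun s' => a * phi s') s = a * avg f phi s.
Proof. by rewrite [RHS]mulr_sumr; apply: eq_bigr => w _; rewrite mulrCA. Qed.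

Lemma avg_le1 f phi s : (forall s', phi s' <= 1) -> avg f phi s <= 1.
Proof. by move=> h; apply: (le_trans (avg_le _ _ h)); rewrite avg_cst. Qed.

Lemma avg_ge0 f phi s : (forall s', 0 <= phi s') -> 0 <= avg f phi s.
Proof. by move=> h; apply: le_trans (avg_le _ _ h); rewrite avg_cst. Qed.

(** Where the rule yields [b], only the noise outcome [~~ b] can spoil it, so avoiding that outcome
    on [S] suffices. *)
Lemma avg_keep f (S : {set site n}) b s : (forall r, r \in S -> f s r = b) ->
  (1 - pr (~~ b)) ^+ #|S| <= avg f (fun s' => [forall r in S, s' r == b]%:R) s.
Proof.
move=> h; rewrite -noise_prob_avoid; apply: ler_sum => w _.
rewrite ler_wpM2l ?noise_prob_ge0 // ler_nat.
case: forall_inP => // hw; case: forall_inP => // -[] r rS; rewrite ffunE.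
by move: (hw _ rS); case: (w r) => [[]|] /=; rewrite ?h //; case: (b).
Qed.

(** A noise outcome [b] overrides the rule, so missing [b] on all of [S] forces the noise to avoid
    [b] there, whatever [f] is. *)
Lemma avg_miss f (S : {set site n}) b s :
  avg f (fun s' => [forall r in S, s' r != b]%:R) s <= (1 - pr b) ^+ #|S|.
Proof.
rewrite -noise_prob_avoid; apply: ler_sum => w _.
rewrite ler_wpM2l ?noise_prob_ge0 // ler_nat.
case: forall_inP => // hw; case: forall_inP => // -[] r rS.
by move: (hw _ rS); rewrite ffunE; case: (w r) => // c; apply: contraNN => /eqP[->].
Qed.

Lemma avg_not f (P : pred (config n)) s :
  avg f (fun s' => (~~ P s')%:R) s = 1 - avg f (fun s' => (P s')%:R) s.
Proof.
rewrite -[X in X - _](avg_cst f 1 s) -[X in _ - X]mul1r -mulNr -avgZ -avgD.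
by apply: eq_avg => s'; case: (P s') => /=; ring.
Qed.

Definition mean (g : site n -> R) : R := (\sum_y g y) / (n.+1 ^ 2)%:R.

Lemma mean_le g h : (forall y, g y <= h y) -> mean g <= mean h.
Proof. by move=> gh; rewrite ler_wpM2r ?invr_ge0 ?ler0n // ler_sum. Qed.

Lemma mean_cst (a : R) : mean (fun=> a) = a.
Proof.
by rewrite /mean sumr_const card_prod card_ord -[_ *+ _]mulr_natr mulfK // pnatr_eq0.
Qed.

Lemma mean_affine (k l : R) g : mean (fun y => k + l * g y) = k + l * mean g.
Proof. by rewrite -{2}[k]mean_cst /mean mulrA mulr_sumr -mulrDl -big_split. Qed.

Lemma avg_mean f (phi : site n -> config n -> R) s :
  avg f (fun s' => mean (phi^~ s')) s = mean (fun y => avg f (phi y) s).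
Proof.
rewrite /mean exchange_big mulr_suml; apply: eq_bigr => w _.
by rewrite mulrA mulr_sumr.
Qed.

Definition dens (P : pred (site n)) : R := mean (fun y => (P y)%:R).

Lemma dens_ge0 P : 0 <= dens P.
Proof. by rewrite -(mean_cst 0) mean_le. Qed.

Lemma dens_le1 P : dens P <= 1.
Proof. by rewrite -(mean_cst 1) mean_le // => y; rewrite lern1 leq_b1. Qed.

(** * Drift of the Lyapunov function over one shrink-spread period *)

Section Drift.
Variables (b : bool) (N : site n -> {set site n}) (d : nat).
Variables (fsh fsp : config n -> site n -> bool).
Hypothesis card_out : forall r, (#|N r| <= d)%N.
Hypothesis card_in : forall y, (d <= #|[set r | y \in N r]|)%N.
Hypothesis d_gt0 : (0 < d)%N.
Hypothesis fshP : forall s r, (forall z, z \in N r -> s z = b) -> fsh s r = b.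
Hypothesis fspP : forall s y, fsp s y = b <-> exists2 r, y \in N r & s r = b.
Hypothesis pr_gt0 : 0 < pr b.
Hypothesis pr_le : pr (~~ b) <= pr b.

Let al := pr b.
Let be := pr (~~ b).
Let kap := 1 - (1 - be) ^+ d.+1.
Let lam := (1 - al) ^+ d - kap.
(* The weight for which the [u]-terms cancel in the drift of [lyap]. *)
Let C := (1 - p) / (1 - lam).

Let be_ge0 : 0 <= be. Proof. exact: outcome_prob_ge0. Qed.
Let alD : al + be = p. Proof. exact: outcome_probD. Qed.
Let p_le1 : p <= 1. Proof. by case: hpe => /andP[]. Qed.

Let q_itv : 0 <= 1 - be <= 1.
Proof. by move: alD p_le1 pr_gt0 be_ge0; rewrite /al /be => *; apply/andP; split; lra. Qed.

(** As [kap >= 0] and [d >= 1], [lam] is at most [1 - al]. This keeps the denominator of [C]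
    positive and bounds [C] by the inverse of [al], independently of [d] and [n]. *)
Let lam_le : 1 - lam >= al.
Proof.
have [q0 q1] := andP q_itv.
have h1 : (1 - be) ^+ d.+1 <= 1 by rewrite exprn_ile1.
have h2 : (1 - al) ^+ d <= 1 - al.
  by rewrite -(prednK d_gt0) exprS ler_piMr ?exprn_ile1 //; move: alD p_le1 be_ge0 pr_gt0;
     rewrite /al /be => *; lra.
by rewrite /lam /kap; lra.
Qed.

Let C_ge0 : 0 <= C.
Proof.
by apply: divr_ge0; [rewrite subr_ge0 | apply: le_trans lam_le; apply: ltW].
Qed.

(** The first term is what being alive bounds from below; the second is the weighted mean fraction
    of sites out of reach once the shrinking half-step has been made. *)
Definition lyap s : R :=
  dens (fun y => s y != b) + C * avg fsh (fun s' => dens (fun y => fsp s' y != b)) s.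

Lemma lyap_ge0 s : 0 <= lyap s.
Proof.
by rewrite addr_ge0 ?dens_ge0 // mulr_ge0 // avg_ge0 // => s'; apply: dens_ge0.
Qed.

Lemma lyap_le s : lyap s <= 1 + (pr b)^-1.
Proof.
rewrite lerD ?dens_le1 // -[leRHS]mulr1 ler_pM //.
- by apply: avg_ge0 => s'; apply: dens_ge0.
- rewrite -[leRHS]mul1r ler_pM ?subr_ge0 //.
  + by rewrite invr_ge0; apply: le_trans lam_le; apply: ltW.
  + by move: alD be_ge0 pr_gt0; rewrite /al /be => *; lra.
  + by rewrite lef_pV2 // posrE (lt_le_trans _ lam_le).
- by apply: avg_le1 => s'; apply: dens_le1.
Qed.

Lemma avg_spread s :
  avg fsp (fun s' => dens (fun y => s' y != b)) s
  <= be + (1 - p) * dens (fun y => fsp s y != b).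
Proof.
rewrite (avg_mean fsp (fun y s' => (s' y != b)%:R)) -mean_affine; apply: mean_le => y.
case: (eqVneq (fsp s y) b) => [fy|_] /=; rewrite ?mulr0 ?mulr1 ?addr0.
  rewrite (avg_not fsp (fun s' => s' y == b)) lerBlDr -lerBlDl.
  have := @avg_keep fsp [set y] b s; rewrite cards1 expr1 => keep.
  apply: le_trans (keep _) _ => [r|]; first by rewrite inE => /eqP->.
  apply: avg_le => s'; rewrite ler_nat.
  by case: forall_inP => // /(_ y); rewrite inE eqxx => ->.
have := avg_miss fsp [set y] b s; rewrite cards1 expr1 => miss.
(* For a site out of reach the target [be + (1 - p)] equals [1 - al]. *)
apply: (@le_trans _ _ (1 - al)); last by rewrite -alD; lra.
apply: le_trans miss; apply: avg_le => s'; rewrite ler_nat.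
case: forall_inP => [_|]; first exact: leq_b1.
by case: eqP => // ne []; move=> r; rewrite inE => /eqP->; apply/eqP.
Qed.

Lemma avg_spread_shrink s :
  avg fsp (avg fsh (fun s' => dens (fun y => fsp s' y != b))) s
  <= kap + lam * dens (fun y => fsp s y != b).
Proof.
have [q0 q1] := andP q_itv.
have E := avg_mean fsh (fun y s' => (fsp s' y != b)%:R).
rewrite (eq_avg _ _ E) (avg_mean fsp (fun y => avg fsh (fun s' => (fsp s' y != b)%:R))).
rewrite -mean_affine; apply: mean_le => y.
(* If [y] is in reach through [r], the same [r] serves again: spreading fills [N r], which survives
   the noise with probability at least [(1 - be) ^+ d], and shrinking then keeps [r] with one more
   factor [1 - be]. *)
case: (eqVneq (fsp s y) b) => [/fspP[r yr rb]|_] /=; rewrite ?mulr0 ?mulr1 ?addr0.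
  apply: (@le_trans _ _ (avg fsp (fun s' => 1 - (1 - be) *
      [forall z in N r, s' z == b]%:R) s)).
    apply: avg_le => s'; rewrite (avg_not fsh (fun s'' => fsp s'' y == b)) lerB //.
    case: forall_inP => [h|_]; last by rewrite mulr0 avg_ge0.
    have := @avg_keep fsh [set r] b s'; rewrite cards1 expr1 mulr1 => keep.
    apply: le_trans (keep _) _ => [r'|].
      by rewrite inE => /eqP->; apply: fshP => z /h/eqP.
    apply: avg_le => s''; rewrite ler_nat.
    case: forall_inP => // /(_ r); rewrite inE eqxx => /(_ isT)/eqP hr.
    by rewrite (fspP s'' y).2 ?eqxx //; exists r.
  under eq_avg do rewrite -mulNr.
  rewrite avgD avg_cst avgZ mulNr lerB // exprS ler_wpM2l //.
  apply: le_trans (avg_keep _); last by move=> z zr; apply/fspP; exists r.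
  exact: ler_wiXn2l.
rewrite addrC subrK.
(* If [y] is out of reach, the noise of the shrinking half-step alone gives the bound, from any
   intermediate [s']. *)
rewrite -[leRHS](avg_cst fsp _ s); apply: avg_le => s'.
apply: (@le_trans _ _ ((1 - al) ^+ #|[set r | y \in N r]|)); last first.
  apply: ler_wiXn2l => //; move: alD p_le1 be_ge0 pr_gt0; rewrite /al /be => *; lra.
apply: le_trans (avg_miss fsh _ b s'); apply: avg_le => s''; rewrite ler_nat.
case: forall_inP => [_|]; first exact: leq_b1.
case: eqP => // ne []; move=> r; rewrite inE => yr; apply/eqP => rb.
by apply: ne; apply/fspP; exists r.
Qed.

(* The affine recursion of [avg_spread_shrink] has a fixed point at most 2/3. *)
Let kap_le : 3 * kap <= 2 * (1 - lam).
Proof.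
have [q0 q1] := andP q_itv.
have h : (1 - al) ^+ d <= (1 - be) ^+ d.
  by apply: lerXn2r; rewrite ?nnegrE //; move: alD p_le1 be_ge0 pr_le pr_gt0;
     rewrite /al /be => *; lra.
have h2 : (1 - be) ^+ d <= 1 - be.
  by rewrite -(prednK d_gt0) exprS ler_piMr ?exprn_ile1.
have h0 : 0 <= (1 - be) ^+ d by rewrite exprn_ge0.
rewrite /lam /kap exprS.
set z := (1 - be) ^+ d in h h0 h2 *; set x := (1 - al) ^+ d in h *.
(* Since [x <= z], the claim reduces to [z * (1 + be) <= 1], which follows from [z <= 1 - be]. *)
have : z * (1 + be) <= (1 - be) * (1 + be) by rewrite ler_wpM2r //; lra.
have : 0 <= be * be by rewrite mulr_ge0.
by lra.
Qed.

(** The two bounds above add up to [be + C * kap] plus the out-of-reach fraction times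
    [(1 - p) + C * lam], and the choice of [C] makes this factor equal to [C]. Only the first term
    of [lyap s] is then lost. *)
Lemma lyap_drift s :
  avg fsh (avg fsp lyap) s <= lyap s + 2 / 3 - dens (fun y => s y != b).
Proof.
have lam0 : 0 < 1 - lam by rewrite (lt_le_trans _ lam_le).
have CE : C * (1 - lam) = 1 - p by rewrite /C mulfVK // gt_eqF.
(* By [kap_le], [C * kap] is at most [2 / 3 * (1 - p)], while [be <= p / 2]. *)
have Ck : be + C * kap <= 2 / 3.
  have : C * (3 * kap) <= C * (2 * (1 - lam)) by rewrite ler_wpM2l.
  rewrite [C * (2 * _)]mulrCA CE; move: alD pr_le p_le1 pr_gt0; rewrite /al /be => *; lra.
apply: (@le_trans _ _ (avg fsh (fun s' => (be + C * kap)
   + C * dens (fun y => fsp s' y != b)) s)).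
  apply: avg_le => s'; rewrite /lyap avgD avgZ.
  apply: le_trans (lerD (avg_spread s') (ler_wpM2l C_ge0 (avg_spread_shrink s'))) _.
  by rewrite -CE; lra.
by rewrite avgD avg_cst avgZ /lyap; lra.
Qed.

End Drift.
End OneStep.

(** * Stencils and their opposites on the torus *)

Section Torus.
Variable n : nat.
Implicit Types (x y : 'I_n.+1) (r z : site n) (A B : seq vec).

Lemma ord_injz x y : x%:Z = y%:Z -> x = y.
Proof. by case=> /val_inj. Qed.

Lemma val_shift1 x (d : int) : (shift1 x d)%:Z = ((x%:Z + d) %% n.+1%:Z)%Z.
Proof.
have ge0 : (0 <= (x%:Z + d) %% n.+1%:Z)%Z by rewrite modz_ge0.
rewrite /shift1 inordK ?gez0_abs //.
by rewrite -ltz_nat gez0_abs // ltz_pmod.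
Qed.

Lemma shift1K x (d : int) : shift1 (shift1 x d) (- d) = x.
Proof.
apply: ord_injz; rewrite !val_shift1 modzDml addrK.
by rewrite modz_small // ltz_nat ltn_ord.
Qed.

Lemma shift1_reflect x y (d : int) :
  shift1 x (y%:Z - (shift1 y (- d))%:Z) = shift1 x d.
Proof.
apply: ord_injz; rewrite !val_shift1.
by rewrite addrA -[LHS]modzDmr modzNm modzDmr opprD opprK addrA addrK.
Qed.

Definition oppv (d : vec) : vec := (- d.1, - d.2).

Lemma oppvK : involutive oppv.
Proof. by case=> d1 d2; rewrite /oppv /= !opprK. Qed.

Lemma shiftK r d : Defs.shift (Defs.shift r d) (oppv d) = r.
Proof. by case: r => x y; rewrite /Defs.shift /= !shift1K. Qed.

(** A set, so that vectors of the stencil that coincide modulo the lattice side count once: the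
    powers in the drift count independent sites. *)
Definition neigh A r : {set site n} := [set z in [seq Defs.shift r d | d <- A]].

Lemma neighP A r z : reflect (exists2 d, d \in A & z = Defs.shift r d) (z \in neigh A r).
Proof. by rewrite inE; apply: mapP. Qed.

Lemma neigh_opp A B r z : (forall d, d \in B <-> oppv d \in A) ->
  (z \in neigh A r) = (r \in neigh B z).
Proof.
move=> hB; apply/neighP/neighP => -[d dA ->]; exists (oppv d); rewrite ?shiftK //.
  by apply/hB; rewrite oppvK.
exact/hB.
Qed.

(** The point reflection sending [z'] to [r + z - z'] takes [z - d] to [r + d], so it maps
    [neigh B z] over [neigh A r]. *)
Lemma card_neigh_opp A B r z : (forall d, d \in B <-> oppv d \in A) ->
  (#|neigh A r| <= #|neigh B z|)%N.
Proof.
move=> hB; pose g (z' : site n) := Defs.shift r (z.1%:Z - z'.1%:Z, z.2%:Z - z'.2%:Z).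
apply: leq_trans (leq_imset_card g _); apply/subset_leq_card/fintype.subsetP => _ /neighP[d dA ->].
apply/imsetP; exists (Defs.shift z (oppv d)); last by rewrite /g /Defs.shift /= !shift1_reflect.
by apply/neighP; exists (oppv d) => //; apply/hB; rewrite oppvK.
Qed.

End Torus.

(** * Noise histories and the sum of survival probabilities *)

Section History.
Variables (R : realType) (p eta : R) (Rw Rv : seq vec) (n : nat).
Hypothesis hpe : valid_params p eta.

Definition extend (t : nat) (W : {ffun 'I_t -> noise n}) (w : noise n) :
  {ffun 'I_t.+1 -> noise n} := [ffun i => oapp W w (unlift ord_max i)].

Lemma sum_extend t (F : {ffun 'I_t.+1 -> noise n} -> R) :
  \sum_W F W = \sum_W \sum_w F (extend W w).
Proof.
rewrite pair_big /= (reindex (fun Ww : {ffun 'I_t -> noise n} * noise n =>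
  extend Ww.1 Ww.2)) //=.
exists (fun W => ([ffun i => W (lift ord_max i)], W ord_max)) => [[W w] _|W _] /=.
  rewrite ffunE unlift_none /=; congr (_, _); apply/ffunP => i.
  by rewrite !ffunE liftK.
by apply/ffunP => i; rewrite ffunE; case: unliftP => [j|] -> //=; rewrite ffunE.
Qed.

Lemma hist_extend_lt t (W : {ffun 'I_t -> noise n}) w k :
  (k < t)%N -> hist (extend W w) k = hist W k.
Proof.
move=> kt; rewrite /hist (insubT (fun i => (i < t)%N) kt).
rewrite (insubT (fun i => (i < t.+1)%N) (ltnW kt)) /= ffunE.
have -> : Sub k (ltnW kt : (k < t.+1)%N) = lift ord_max (Ordinal kt) :> 'I_t.+1.
  by apply: val_inj; rewrite /= /bump leqNgt kt.
by rewrite liftK.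
Qed.

Lemma hist_extend t (W : {ffun 'I_t -> noise n}) w : hist (extend W w) t = w.
Proof.
rewrite /hist (insubT (fun i => (i < t.+1)%N) (ltnSn t)) /= ffunE.
have -> : Sub t (ltnSn t) = ord_max :> 'I_t.+1 by apply: val_inj.
by rewrite unlift_none.
Qed.

Lemma traj_eq (W W' : nat -> noise n) k s :
  (forall i, (i < k)%N -> W i = W' i) -> traj Rw Rv W k s = traj Rw Rv W' k s.
Proof.
elim: k => //= k IH h; rewrite h // IH // => i ik.
by rewrite h // (leq_trans ik).
Qed.

Lemma traj_extend t (W : {ffun 'I_t -> noise n}) w k s : (k <= t)%N ->
  traj Rw Rv (hist (extend W w)) k s = traj Rw Rv (hist W) k s.
Proof.
by move=> kt; apply: traj_eq => i ik; rewrite hist_extend_lt // (leq_trans ik).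
Qed.

Lemma traj_extendS t (W : {ffun 'I_t -> noise n}) w s :
  traj Rw Rv (hist (extend W w)) t.+1 s
  = upd (rule Rw Rv t) w (traj Rw Rv (hist W) t s).
Proof. by rewrite /= hist_extend traj_extend. Qed.

Lemma alive_extend t (W : {ffun 'I_t -> noise n}) w :
  alive R Rw Rv (extend W w) -> alive R Rw Rv W.
Proof.
move=> /forallP h; apply/forallP => k.
have := h (widen_ord (leqnSn t.+1) k).
by rewrite /= !traj_extend // -ltnS.
Qed.

Definition hist_prob t (W : {ffun 'I_t -> noise n}) : R :=
  \prod_(i < t) noise_prob p eta (W i).

Lemma hist_prob_ge0 t (W : {ffun 'I_t -> noise n}) : 0 <= hist_prob W.
Proof. by apply: prodr_ge0 => i _; apply: noise_prob_ge0. Qed.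

Lemma hist_prob_extend t (W : {ffun 'I_t -> noise n}) w :
  hist_prob (extend W w) = hist_prob W * noise_prob p eta w.
Proof.
rewrite /hist_prob big_ord_recr /=; congr (_ * _).
  apply: eq_bigr => i _; rewrite ffunE.
  have -> : widen_ord (leqnSn t) i = lift ord_max i.
    by apply: val_inj; rewrite /= /bump leqNgt ltn_ord.
  by rewrite liftK.
by rewrite ffunE unlift_none.
Qed.

Definition avg_alive (s0 : config n) t (phi : config n -> R) : R :=
  \sum_(W : {ffun 'I_t -> noise n})
    hist_prob W * (alive R Rw Rv W)%:R * phi (traj Rw Rv (hist W) t s0).

Lemma avg_alive_le s0 t phi psi :
  (forall W : {ffun 'I_t -> noise n}, alive R Rw Rv W ->
     phi (traj Rw Rv (hist W) t s0) <= psi (traj Rw Rv (hist W) t s0)) ->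
  avg_alive s0 t phi <= avg_alive s0 t psi.
Proof.
move=> h; apply: ler_sum => W _; case: (boolP (alive R Rw Rv W)) => [aW|_].
  by rewrite mulr1 ler_wpM2l ?hist_prob_ge0 // h.
by rewrite mulr0 !mul0r.
Qed.

Lemma avg_alive_ge0 s0 t phi : (forall s, 0 <= phi s) -> 0 <= avg_alive s0 t phi.
Proof.
by move=> h; apply: sumr_ge0 => W _; rewrite !mulr_ge0 ?hist_prob_ge0 ?ler0n.
Qed.

(** Being alive at time [t.+1] implies being alive at time [t]; weakening the condition can only
    increase the average of a nonnegative [phi]. *)
Lemma avg_aliveS s0 t phi : (forall s, 0 <= phi s) ->
  avg_alive s0 t.+1 phi <= avg_alive s0 t (avg p eta (rule Rw Rv t) phi).
Proof.
move=> phi0; rewrite /avg_alive sum_extend; apply: ler_sum => W _.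
rewrite mulr_sumr; apply: ler_sum => w _.
rewrite hist_prob_extend traj_extendS mulrA ler_wpM2r //.
rewrite mulrAC ler_wpM2r ?noise_prob_ge0 // ler_wpM2l ?hist_prob_ge0 // ler_nat.
by case: (boolP (alive R Rw Rv (extend W w))) => // /alive_extend ->.
Qed.

Lemma survE s0 t : surv Rw Rv n p eta t = avg_alive s0 t (fun=> 1).
Proof. by apply: eq_bigr => W _; rewrite mulr1. Qed.

Lemma surv_ge0 t : 0 <= surv Rw Rv n p eta t.
Proof. by rewrite (survE (splus n)) avg_alive_ge0. Qed.

Lemma surv_nonincreasing t : surv Rw Rv n p eta t.+1 <= surv Rw Rv n p eta t.
Proof.
rewrite !(survE (splus n)); apply: le_trans (avg_aliveS _ _ _) _ => //.
by apply: avg_alive_le => W _; rewrite avg_cst.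
Qed.

Lemma surv0_le1 : surv Rw Rv n p eta 0 <= 1.
Proof.
rewrite /surv; apply: (@le_trans _ _ (\sum_(W : {ffun 'I_0 -> noise n}) 1)).
  by apply: ler_sum => W _; rewrite big_ord0 mul1r lern1 leq_b1.
by rewrite sumr_const card_ffun card_ord expn0.
Qed.

Lemma tmem_le (K : R) :
  (forall N, \sum_(0 <= t < N) surv Rw Rv n p eta t <= K) ->
  (tmem Rw Rv n p eta <= K%:E)%E.
Proof.
move=> h; apply: lime_le.
  by apply: is_cvg_nneseries => t _ _; rewrite lee_fin surv_ge0.
by apply: nearW => N; rewrite sumEFin lee_fin.
Qed.

(** The magnetisation towards [~~ b] is [2 * x - 1] for a fraction [x] of spins [~~ b], and it is at
    least 1/2 exactly when [x >= 3 / 4]. *)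
Lemma alive_dens b t (W : {ffun 'I_t -> noise n}) : alive R Rw Rv W ->
  3 / 4 <= @dens R n (fun y => traj Rw Rv (hist W) t [ffun => ~~ b] y != b).
Proof.
move=> /forallP /(_ ord_max) /= /andP[hp hm].
have E s : magn R s = 1 - 2 * @dens R n (fun y => s y != true).
  rewrite -mulNr -(mean_affine 1 (-2)) /magn mulrC /mean; congr (_ / _).
  by apply: eq_bigr => y _; rewrite /spin; case: (s y) => /=; lra.
have E' s : magn R s = - (1 - 2 * @dens R n (fun y => s y != false)).
  rewrite -mulNr -(mean_affine 1 (-2)) /magn mulrC /mean -mulNr -sumrN; congr (_ / _).
  by apply: eq_bigr => y _; rewrite /spin; case: (s y) => /=; lra.
case: b.
  by move: hm; rewrite E /sminus /=; lra.
by move: hp; rewrite E' /splus /=; lra.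
Qed.

(** While alive, [V] loses at least [3 / 4 - 2 / 3 = 1 / 12] per period on average, and the losses
    telescope. Here [e] is the parity of the times at which a period starts; 24 is 12 for each of
    the two times in a period. *)
Lemma sum_surv_le (b e : bool) (B : R) (V : config n -> R) :
  (forall s, 0 <= V s <= B) ->
  (forall t s, odd t = e ->
     avg p eta (rule Rw Rv t) (avg p eta (rule Rw Rv t.+1) V) s
     <= V s + 2 / 3 - dens R (fun y => s y != b)) ->
  forall N, \sum_(0 <= t < N) surv Rw Rv n p eta t <= 1 + 24 * B.
Proof.
move=> V_bd V_drift.
have V0 s : 0 <= V s by case/andP: (V_bd s).
pose s0 : config n := [ffun => ~~ b]; pose S := surv Rw Rv n p eta.
have B0 : 0 <= B by case/andP: (V_bd s0) => h1 h2; apply: le_trans h2.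
have two_steps t : odd t = e ->
    S t + 12 * avg_alive s0 t.+2 V <= 12 * avg_alive s0 t V.
  move=> te; rewrite /S (survE s0) -lerBrDl.
  have -> : 12 * avg_alive s0 t V - avg_alive s0 t (fun=> 1)
            = 12 * avg_alive s0 t (fun s => V s - 1 / 12).
    rewrite /avg_alive !mulr_sumr -sumrB; apply: eq_bigr => W _; lra.
  rewrite ler_wpM2l //; apply: le_trans (avg_aliveS _ _ V0) _.
  apply: le_trans (avg_aliveS _ _ _) _ => [s|]; first exact: avg_ge0.
  apply: avg_alive_le => W /(alive_dens b) hW.
  by apply: le_trans (V_drift _ _ te) _; rewrite -/s0 in hW *; lra.
(* The periods start at time [e]; the summand 1 pays for time 0 when [e] is 1. Within a period the
   second survival probability is at most the first. *)
have main J : \sum_(0 <= t < e + J.*2) S t + 24 * avg_alive s0 (e + J.*2)%N V <= 1 + 24 * B.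
  elim: J => [|J IH].
    rewrite addn0; have h0 : S 0 <= 1 := surv0_le1.
    have hV : avg_alive s0 e V <= B.
      apply: (@le_trans _ _ (avg_alive s0 0 (fun=> B))).
        case: (e) => /=; last first.
          by apply: avg_alive_le => W _; case/andP: (V_bd (traj Rw Rv (hist W) 0 s0)).
        apply: le_trans (avg_aliveS _ _ V0) _; apply: avg_alive_le => W _.
        rewrite -[leRHS](avg_cst p eta (rule Rw Rv 0) B (traj Rw Rv (hist W) 0 s0)).
        by apply: avg_le => // s; case/andP: (V_bd s).
      have -> : avg_alive s0 0 (fun=> B) = B * S 0.
        rewrite /S (survE s0) /avg_alive mulr_sumr; apply: eq_bigr => W _; ring.
      by rewrite ler_piMr.
    rewrite lerD // ?ler_wpM2l //.
    by case: (e); rewrite /= ?big_nat1 ?big_geq.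
  rewrite doubleS !addnS !big_nat_recr //=.
  have := @two_steps (e + J.*2)%N; rewrite oddD odd_double addbF oddb => /(_ erefl).
  have := surv_nonincreasing (e + J.*2)%N; rewrite -/S.
  move: IH; lra.
move=> N; apply: le_trans (main N).
rewrite [in leRHS](big_cat_nat (n := N)) //=; last by rewrite -addnn; lia.
rewrite -addrA lerDl addr_ge0 //; first by apply: sumr_ge0 => t _; apply: surv_ge0.
by rewrite mulr_ge0 // avg_alive_ge0.
Qed.

End History.

(** * Application to the squeezing code *)

Section Squeezing.
Variables (R : realType) (p eta : R) (Rw Rv : seq vec) (n : nat).
Hypothesis hpe : valid_params p eta.
Hypothesis hR : forall d : vec, d \in Rv <-> (- d.1, - d.2) \in Rw.

(** An empty conjunction ignores its input, so both starts agree from time 1 on and cannot both be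
    alive; only [t = 0] contributes. *)
Lemma sum_surv_nil N : Rw = [::] -> \sum_(0 <= t < N) surv Rw Rv n p eta t <= 1.
Proof.
move=> Rw0; case: N => [|N]; first by rewrite big_geq.
rewrite big_nat_recl // -[leRHS]addr0 lerD ?surv0_le1 //.
rewrite big1 // => t _; rewrite /surv big1 // => W _.
case: (boolP (alive R Rw Rv W)) => [/forallP/(_ (inord 1))|_]; last by rewrite mulr0.
rewrite inordK //=.
have -> : step Rw Rv 0 (hist W 0) (sminus n) = step Rw Rv 0 (hist W 0) (splus n).
  by apply/ffunP => r; rewrite !ffunE /rule /= Rw0 !big_nil.
by move=> /andP[? ?]; lra.
Qed.

Lemma sum_surv_bounded b N : 0 < outcome_prob p eta (Some b) ->
  outcome_prob p eta (Some (~~ b)) <= outcome_prob p eta (Some b) ->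
  \sum_(0 <= t < N) surv Rw Rv n p eta t
  <= 1 + 24 * (1 + (outcome_prob p eta (Some b))^-1).
Proof.
move=> pr_gt0 pr_le; have [/(sum_surv_nil N) h|Rw0] := eqVneq Rw [::].
  by apply: le_trans h _; rewrite lerDl mulr_ge0 // addr_ge0 // invr_ge0 ltW.
(* [A] is the shrinking stencil: the conjunction shrinks the set of true spins, the disjunction that
   of false ones. Shrinking thus happens at times of parity [~~ b]. *)
pose A := if b then Rw else Rv; pose B := if b then Rv else Rw.
have hB d : d \in B <-> oppv d \in A.
  by rewrite /A /B; case: (b) => //; rewrite hR -/(oppv (oppv d)) oppvK.
have hA d : d \in A <-> oppv d \in B by rewrite hB oppvK.
pose r0 : site n := (ord0, ord0); pose d := #|neigh A r0|.
have card_out (r : site n) : (#|neigh A r| <= d)%N.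
  (* Two reflections, through the opposite stencil and back, show that the size does not depend on
     the site. *)
  exact: leq_trans (card_neigh_opp r r0 hB) (card_neigh_opp r0 r0 hA).
have card_in (y : site n) : (d <= #|[set r | y \in neigh A r]|)%N.
  apply: leq_trans (card_neigh_opp r0 y hB) _; apply/subset_leq_card/fintype.subsetP => r.
  by rewrite inE (neigh_opp _ _ hB).
have d_gt0 : (0 < d)%N.
  have [d0 d0A] : exists d0, d0 \in A.
    case E : Rw Rw0 => [|d0 l] // _; have d0R : d0 \in Rw by rewrite E mem_head.
    rewrite /A; case: (b); first by exists d0.
    by exists (oppv d0); apply/hR; rewrite -/(oppv (oppv d0)) oppvK.
  by apply/card_gt0P; exists (Defs.shift r0 d0); apply/neighP; exists d0.
have fshP t : odd t = ~~ b -> forall (s : config n) r,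
    (forall z, z \in neigh A r -> s z = b) -> rule Rw Rv t s r = b.
  rewrite /rule /A => ->; case: (b) => s r h /=.
    by rewrite big_all; apply/allP => d' dA; apply: h; apply/neighP; exists d'.
  rewrite big_has; apply/hasPn => d' dA.
  by rewrite h //; apply/neighP; exists d'.
have fspP t : odd t = ~~ b -> forall (s : config n) y,
    rule Rw Rv t.+1 s y = b <-> exists2 r, y \in neigh A r & s r = b.
  move=> te s y; suff -> : rule Rw Rv t.+1 s y = b <->
      exists2 d', d' \in B & s (Defs.shift y d') = b.
    split=> [[d' dB e]|[r]]; first exists (Defs.shift y d') => //.
      by rewrite (neigh_opp _ _ hB); apply/neighP; exists d'.
    by rewrite (neigh_opp _ _ hB) => /neighP[d' dB ->]; exists d'.
  rewrite /rule /= te /B; case: (b) => /=.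
    by rewrite big_has; split=> [/hasP//|h]; apply/hasP.
  rewrite big_all; split=> [/negbT/allPn[d' dB /negbTE]|[d' dB e]]; first by exists d'.
  by apply/negbTE/allPn; exists d' => //; rewrite e.
pose V : config n -> R := lyap p eta b d (rule Rw Rv (~~ b)) (rule Rw Rv (~~ b).+1).
have V_eq t : odd t = ~~ b -> V = lyap p eta b d (rule Rw Rv t) (rule Rw Rv t.+1).
  have re k k' : odd k = odd k' -> rule Rw Rv k = rule Rw Rv k' :> (config n -> _).
    by move=> e; rewrite /rule e.
  by move=> te; rewrite /V (re t (~~ b)) ?oddb // (re t.+1 (~~ b).+1) //= te oddb.
apply: (@sum_surv_le _ _ _ _ _ _ _ b (~~ b) _ V) => // [s|t s te].
  by rewrite lyap_ge0 // lyap_le.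
rewrite (V_eq t te).
exact: (lyap_drift hpe card_out card_in d_gt0 (fshP t te) (fspP t te)).
Qed.

End Squeezing.

Theorem theorem2 (R : realType) (Rw Rv : seq vec) :
  (forall d : vec, d \in Rv <-> (- d.1, - d.2) \in Rw) ->
  ~ robust_memory R Rw Rv.
Proof.
move=> hR [p0 [eta [rad [rad_gt0 [[/andP[p00 p01] heta] robust]]]]].
have [p [p_gt0 p_le1 p_near]] : exists p, [/\ 0 < p, p <= 1 & (p - p0) ^+ 2 < rad ^+ 2].
  (* A ball centred on the noiseless line still contains points with positive noise; otherwise its
     centre is used. *)
  have [->|p0n] := eqVneq p0 0; last first.
    by exists p0; rewrite subrr expr0n exprn_gt0 // lt_def p0n p00.
  exists (Num.min 1 (rad / 2)); rewrite subr0.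
  have h : 0 < Num.min 1 (rad / 2) by rewrite lt_min ltr01 divr_gt0.
  split=> //; first by rewrite ge_min lexx.
  rewrite ltrXn2r ?nnegrE ?(ltW h) ?(ltW rad_gt0) //.
  by rewrite gt_min; apply/orP; right; lra.
have hpe : valid_params p eta by split=> //; rewrite (ltW p_gt0) p_le1.
have [b [pr_gt0 pr_le]] : exists b, 0 < outcome_prob p eta (Some b) /\
    outcome_prob p eta (Some (~~ b)) <= outcome_prob p eta (Some b).
  have [e0|e0] := leP 0 eta; [exists true | exists false]; split=> /=; nra.
(* [K] does not involve the lattice size, so asking for a memory time of at least [K + 1] on large
   lattices is contradictory. *)
pose K := 1 + 24 * (1 + (outcome_prob p eta (Some b))^-1).
have [] := robust p eta hpe _ (K + 1).
  by rewrite [eta - eta]subrr expr0n addr0.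
move=> N /(_ N (leqnn N)) h.
have : (tmem Rw Rv N p eta <= K%:E)%E.
  by apply: tmem_le => // M; apply: sum_surv_bounded.
by move/(le_trans h); rewrite lee_fin; lra.
Qed.
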